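(* Let $A\in\mathcal{A}=\{0,\dots,M\}$ be a treatment, $Z$ an instrument and $L$ observed covariates. There exists a regular weighting function $\pi(Z,L)$ for $A$ if and only if the strong IV relevance condition holds, i.e. there exists a constant $\epsilon_0>0$ such that for every $l\in\mathcal{L}$ and $a\in\mathcal{A}$, $\mathrm{Var}\{\Pr(A=a\mid Z,L)\mid L=l\}\ge\epsilon_0$. Moreover, for $a\in\mathcal{A}$, if there exists a regular weighting function $\pi(Z,L)$ for $A=a$, then $\Pr(A=a\mid Z,L)$ is a regular weighting function for $A=a$.
   Context: $Z$ takes values in $\mathcal{Z}\subseteq\mathbb{R}^{d_Z}$ (multi-categorical or continuous), $L$ takes values in $\mathcal{L}\subseteq\mathbb{R}^{d_L}$, and $I\{\cdot\}$ denotes an indicator. For $a\in\mathcal{A}$, a function $\pi(Z,L)$ is a regular weighting function (RWF) for $A=a$ if it is uniformly bounded and there exists a constant $\epsilon_0>0$ such that $|\mathrm{Cov}\{I\{A=a\},\pi(Z,L)\mid L\}|\ge\epsilon_0$ uniformly for all values of $L$. It is an RWF for $A$ if it is an RWF for $A=a$ for every $a\in\mathcal{A}$. The constants $\epsilon_0$ in the different conditions need not coincide. *)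

(* Defs.v *)
From HB Require Import structures.
From mathcomp Require Import all_boot all_order all_algebra.
From mathcomp Require Import all_classical all_reals all_analysis.

Set Implicit Arguments.
Unset Strict Implicit.
Unset Printing Implicit Defensive.

Import Order.TTheory GRing.Theory Num.Theory.
Import numFieldNormedType.Exports.

Local Open Scope classical_set_scope.
Local Open Scope ring_scope.

(* Discrete sigma-algebra on the finite treatment set {0, ..., M} = 'I_M.+1. *)
HB.instance Definition _ (n : nat) := isPointed.Build 'I_n.+1 ord0.
HB.instance Definition _ (n : nat) :=
  @isMeasurable.Build default_measure_display 'I_n.+1
    (@discrete_measurable 'I_n.+1) (@discrete_measurable0 _)
    (@discrete_measurableC _) (@discrete_measurableU _).

(* Borel R^n: tuples carry the sigma-algebra generated by the coordinates. *)
Notation Rn R n := (n.-tuple (measurableTypeR R)).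

(* [k] is a regular conditional distribution of [X] given [Y] under [P]:
   P(X \in B, Y \in C) = \int_{Y \in C} k(Y)(B) dP. *)
Definition regular_cond_law d d1 d2 (T : measurableType d)
    (T1 : measurableType d1) (T2 : measurableType d2) (R : realType)
    (P : probability T R) (X : T -> T1) (Y : T -> T2)
    (k : T2 -> pprobability T1 R) : Prop :=
  measurable_fun [set: T2] k /\
  forall (B : set T1) (C : set T2), measurable B -> measurable C ->
    P (X @^-1` B `&` Y @^-1` C) = (\int[P]_(w in Y @^-1` C) k (Y w) B)%E.

Section weighting.
Context {R : realType} {M dZ dL : nat}.

(* In this section [kappa l] is the joint law of (A, Z) given L = l and
   [p (z, l)] is the law of A given (Z, L) = (z, l). Conditional moments given
   L = l are moments under [kappa l], so "for every l" is meant literally.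
   Weighting functions on Zs x Ls are represented by Borel functions on the
   whole space; their values outside Zs x Ls are unconstrained. *)
Variable kappa : Rn R dL -> pprobability ('I_M.+1 * Rn R dZ)%type R.
Variable p : Rn R dZ * Rn R dL -> pprobability 'I_M.+1 R.
Variable Zs : set (Rn R dZ).
Variable Ls : set (Rn R dL).

Definition cond_prob (a : 'I_M.+1) (zl : Rn R dZ * Rn R dL) : R :=
  fine (p zl [set a]).

(* Cov{I{A = a}, f(Z, L) | L = l} *)
Definition cond_cov_treatment (a : 'I_M.+1) (f : Rn R dZ * Rn R dL -> R)
    (l : Rn R dL) : \bar R :=
  covariance (kappa l) (fun az => (az.1 == a)%:R) (fun az => f (az.2, l)).

(* Var{f(Z, L) | L = l} *)
Definition cond_var (f : Rn R dZ * Rn R dL -> R) (l : Rn R dL) : \bar R :=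
  variance (kappa l) (fun az => f (az.2, l)).

Definition RWF_at (a : 'I_M.+1) (f : Rn R dZ * Rn R dL -> R) : Prop :=
  [/\ measurable_fun [set: Rn R dZ * Rn R dL] f,
      exists C : R, forall z l, Zs z -> Ls l -> `|f (z, l)| <= C &
      exists2 eps0 : R, 0 < eps0 &
        forall l, Ls l -> (eps0%:E <= `|cond_cov_treatment a f l|)%E].

Definition RWF (f : Rn R dZ * Rn R dL -> R) : Prop := forall a, RWF_at a f.

Definition strong_IV_relevance : Prop :=
  exists2 eps0 : R, 0 < eps0 &
    forall l a, Ls l -> (eps0%:E <= cond_var (cond_prob a) l)%E.

End weighting.

(* Main.v *)
(* Under the conditional law given L = l, Pr(A = a | Z, L) is the L^2 projection
   of I{A = a} onto the functions of Z, so that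
   Cov{I{A = a}, f | L} = Cov{Pr(A = a | Z, L), f | L}. Cauchy-Schwarz then
   bounds Var{Pr(A = a | Z, L) | L} from below as soon as f is a bounded RWF for
   A = a, and f = Pr(A = a | Z, L) turns the covariance into that variance.
   A function that works for all levels at once is built greedily: given f good
   for the levels b < k with constant d, add (d / 2) Pr(A = k | Z, L) on the
   measurable set of those l where Cov{I{A = k}, f | L = l} is too small. This
   repairs level k and spoils the previous ones by at most d / 2, because
   covariances of conditional probabilities are at most 1 in absolute value. *)
Require Import Defs.
From mathcomp Require Import all_boot all_order all_algebra.
From mathcomp Require Import all_classical all_reals all_analysis.
From mathcomp Require Import measurable_realfun ring lra.

Set Implicit Arguments.
Unset Strict Implicit.
Unset Printing Implicit Defensive.

Import Order.TTheory GRing.Theory Num.Theory.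
Import numFieldNormedType.Exports.

Local Open Scope classical_set_scope.
Local Open Scope ring_scope.

(** * Covariance inequalities for bounded variables, and integrals against functions of [Y] *)

Section bounded_covariance.
Context d (T : measurableType d) (R : realType) (P : probability T R).
Implicit Types (X Y : T -> R) (C : R).

Lemma bounded_Lfun2 X C : measurable_fun [set: T] X ->
  (forall x, `|X x| <= C) -> X \in Lfun P 2%:E.
Proof.
move=> mX XC; apply/andP; split; first by rewrite inE.
rewrite inE /= /finite_norm unlock /Lnorm poweR_lty//.
rewrite (@le_lt_trans _ _ (\int[P]_x (C `^ 2)%:E)%E)//; last first.
  by rewrite integral_cst// ltey_eq fin_numM// fin_num_measure.
apply: ge0_le_integral => //.
- by move=> x _; rewrite lee_fin powR_ge0.
- apply/measurable_EFinP.
  apply: (@measurableT_comp _ _ _ _ _ _ (@powR R ^~ 2)) => //.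
  exact: measurableT_comp.
- by move=> x _; rewrite lee_fin ge0_ler_powR ?nnegrE// (le_trans _ (XC x)).
Qed.

(** Cauchy-Schwarz. The one-sided bound [covariance_le], applied to [Y] and to [\- Y], bounds the
    absolute value; squaring removes the root. *)
Lemma sqr_covariance_le X Y : X \in Lfun P 2%:E -> Y \in Lfun P 2%:E ->
  fine (covariance P X Y) ^+ 2 <= fine 'V_P[X] * fine 'V_P[Y].
Proof.
move=> X2 Y2.
have P1 := fin_num_measure P _ measurableT.
have fXY : covariance P X Y \is a fin_num.
  by rewrite covariance_fin_num ?Lfun2_mul_Lfun1 ?(Lfun_subset12 P1).
have fX := variance_fin_num X2; have fY := variance_fin_num Y2.
have vX : 0 <= fine 'V_P[X] by rewrite fine_ge0// variance_ge0.
have vY : 0 <= fine 'V_P[Y] by rewrite fine_ge0// variance_ge0.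
have le1 Z : Z \in Lfun P 2%:E -> 'V_P[Z] = 'V_P[Y] ->
    covariance P X Z \is a fin_num ->
    fine (covariance P X Z) <= Num.sqrt (fine 'V_P[X] * fine 'V_P[Y]).
  move=> Z2 VZ fXZ; have := covariance_le X2 Z2; rewrite VZ.
  rewrite -(fineK fXZ) -(fineK fX) -(fineK fY) /= -EFinM lee_fin.
  by rewrite sqrtrM.
rewrite -(sqr_sqrtr (mulr_ge0 vX vY)) -real_normK ?num_real//.
rewrite lerXn2r ?nnegrE ?sqrtr_ge0// ler_norml.
rewrite le1// andbT lerNl.
have := @le1 (\- Y).
rewrite covarianceNr ?Lfun2_mul_Lfun1 ?(Lfun_subset12 P1)//.
rewrite fineN; apply; rewrite ?varianceN ?fin_numN//.
by rewrite rpredN.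
Qed.

(** Var X = E[X^2] - (E X)^2 is at most E[X^2], and X^2 is at most C^2 pointwise. *)
Lemma variance_bound X C : measurable_fun [set: T] X ->
  (forall x, `|X x| <= C) -> fine 'V_P[X] <= C ^+ 2.
Proof.
move=> mX XC; have X2 := @bounded_Lfun2 _ _ mX XC.
have X1 := Lfun_subset12 (fin_num_measure P _ measurableT) X2.
have XX1 := Lfun2_mul_Lfun1 X2 X2.
rewrite varianceE// fineB ?fin_numX ?expectation_fin_num//.
have -> : fine ('E_P[X] ^+ 2)%E = fine 'E_P[X] ^+ 2.
  by rewrite fineM ?expectation_fin_num.
rewrite (@le_trans _ _ (fine 'E_P[X ^+ 2]))//.
  by rewrite lerBlDr lerDl sqr_ge0.
rewrite -lee_fin fineK ?expectation_fin_num//.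
rewrite -(expectation_cst P (C ^+ 2)).
apply: expectation_le => //.
- exact: measurable_funM.
- by move=> x; exact: sqr_ge0.
- by move=> x; exact: sqr_ge0.
- apply: aeW => x; rewrite /= -[leLHS]real_normK ?num_real//.
  by rewrite lerXn2r ?nnegrE// (le_trans _ (XC x)).
Qed.

Lemma covariance_ae_eqr X Y Y' : measurable_fun [set: T] X ->
  measurable_fun [set: T] Y -> measurable_fun [set: T] Y' ->
  {ae P, forall x, Y x = Y' x} -> covariance P X Y = covariance P X Y'.
Proof.
move=> mX mY mY' YY'.
have EY : ('E_P[Y] = 'E_P[Y'])%E.
  rewrite unlock; apply: ae_eq_integral => //; try exact/measurable_EFinP.
  by apply: filterS YY' => x YY'x _; rewrite /= YY'x.
rewrite covariance.unlock EY expectation.unlock; apply: ae_eq_integral => //.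
- by apply/measurable_EFinP/measurable_funM; apply: measurable_funB.
- by apply/measurable_EFinP/measurable_funM; apply: measurable_funB.
- by apply: filterS YY' => x YY'x _; rewrite /= fctE /= YY'x.
Qed.

Import HBNNSimple.

(** Equality of the integrals of [u] and [v] over all events of the form Y in B passes to simple
    functions of [Y] by linearity, then to nonnegative measurable [g] by monotone convergence. *)
Lemma ge0_integral_factor d2 (T2 : measurableType d2) (u v : T -> R)
    (Y : T -> T2) (g : T2 -> R) :
  measurable_fun [set: T] u -> measurable_fun [set: T] v ->
  (forall x, 0 <= u x) -> (forall x, 0 <= v x) -> measurable_fun [set: T] Y ->
  (forall B, measurable B ->
    \int[P]_(x in Y @^-1` B) (u x)%:E = \int[P]_(x in Y @^-1` B) (v x)%:E)%E ->
  measurable_fun [set: T2] g -> (forall y, 0 <= g y) ->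
  (\int[P]_x (g (Y x) * u x)%:E = \int[P]_x (g (Y x) * v x)%:E)%E.
Proof.
move=> mu mv u0 v0 mY uv mg g0.
have mg' : measurable_fun [set: T2] (EFin \o g) by exact/measurable_EFinP.
have g0' y : [set: T2] y -> (0 <= (EFin \o g) y)%E by rewrite /= lee_fin.
pose h := nnsfun_approx measurableT mg'.
(* The right-hand side sees [w] only through its integrals over preimages under [Y], so it takes the
   same value for [u] and [v]. *)
have hE (w : T -> R) : measurable_fun [set: T] w -> (forall x, 0 <= w x) ->
    (\int[P]_x (g (Y x) * w x)%:E =
     lim (\sum_(y \in range (h n)) (y%:E *
       \int[P]_(x in Y @^-1` (h n @^-1` [set y])) (w x)%:E) @[n --> \oo]))%E.
  move=> mw w0.
  have mhY n : measurable_fun [set: T] (h n \o Y) by apply: measurableT_comp.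
  have mhYy n y : measurable (Y @^-1` (h n @^-1` [set y])).
    by rewrite -[X in measurable X]setTI; apply: mY.
  have -> : (\int[P]_x (g (Y x) * w x)%:E =
      \int[P]_x lim ((h n (Y x) * w x)%:E @[n --> \oo]))%E.
    apply: eq_integral => x _; apply/esym/cvg_lim => //.
    under eq_fun do rewrite EFinM; rewrite EFinM.
    by apply: cvgeZr => //; apply: (cvg_nnsfun_approx measurableT mg').
  rewrite monotone_convergence//.
  - congr (limn _); apply/funext => n.
    (* The simple function [h n] is expanded as the sum of its values times the indicators of its
       level sets. *)
    transitivity (\int[P]_x (\sum_(y \in range (h n))
      (y * (w x * \1_(Y @^-1` (h n @^-1` [set y])) x))%:E))%E.
      apply: eq_integral => x _.
      rewrite fsumEFin//; congr EFin.
      rewrite (fimfunE (h n) (Y x)) mulrC mulr_fsumr//.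
      by apply: eq_fsbigr => y _; rewrite mulrCA.
    rewrite ge0_integral_fsum//; last 2 first.
    + move=> y; apply/measurable_EFinP; apply: measurable_funM => //.
      apply: measurable_funM => //; exact: measurable_indic.
    + move=> n' x _; rewrite lee_fin.
      rewrite mulrCA mulr_ge0// -lee_fin; exact: nnfun_muleindic_ge0.
    + apply: eq_fsbigr => y; rewrite inE => -[t _ <-].
      under eq_integral do rewrite EFinM.
      rewrite ge0_integralZl_EFin//; last 2 first.
        by move=> x _; rewrite lee_fin mulr_ge0.
        by apply/measurable_EFinP/measurable_funM.
      by congr (_ * _)%E; rewrite [RHS]integral_mkcond epatch_indic.
  - move=> n; apply/measurable_EFinP; exact: measurable_funM (mhY n) mw.
  - by move=> n x _; rewrite lee_fin mulr_ge0.
  - move=> x _ m n mn; rewrite lee_fin ler_wpM2r//.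
    by have /lefP := @nd_nnsfun_approx _ _ _ _ measurableT _ mg' m n mn; exact.
rewrite !hE//; congr (limn _); apply/funext => n.
by apply: eq_fsbigr => y _; rewrite uv.
Qed.

End bounded_covariance.

(** * Measurable dependence of an expectation on the parameter of a kernel *)

Section kernel_expectation.
Context d1 d2 (X : measurableType d1) (Y : measurableType d2) (R : realType).

(** Positive and negative parts are treated separately, since integrals of nonnegative functions
    against a finite kernel are measurable in the parameter. *)
Lemma measurable_expectation_kernel (k : X -> pprobability Y R)
    (g : X * Y -> R) :
  measurable_fun [set: X] k -> measurable_fun [set: X * Y] g ->
  measurable_fun [set: X] (fun x => 'E_(k x)[fun y => g (x, y)])%E.
Proof.
move=> mk mg.
have mg' : measurable_fun [set: X * Y] (EFin \o g) by exact/measurable_EFinP.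
rewrite expectation.unlock.
have -> : (fun x => \int[k x]_y (g (x, y))%:E)%E =
    (fun x => \int[kprobability mk x]_y (EFin \o g)^\+ (x, y) -
              \int[kprobability mk x]_y (EFin \o g)^\- (x, y))%E.
  by apply/funext => x; rewrite [LHS]integralE; congr (_ - _)%E;
    apply: eq_integral => y _; rewrite ?funeposE ?funenegE.
apply: emeasurable_funB.
- apply: (measurable_fun_integral_finite_kernel
    (EFin \o g)^\+%E (kprobability mk)) => //.
  exact: measurable_funepos.
- apply: (measurable_fun_integral_finite_kernel
    (EFin \o g)^\-%E (kprobability mk)) => //.
  exact: measurable_funeneg.
Qed.

End kernel_expectation.

(** * Conditional moments given L = l and the projection of the treatment indicator *)

Section weighting_functions.
Context {R : realType} {M dZ dL : nat}.
Variable kappa : Rn R dL -> pprobability ('I_M.+1 * Rn R dZ)%type R.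
Variable p : Rn R dZ * Rn R dL -> pprobability 'I_M.+1 R.
Variable Zs : set (Rn R dZ).
Variable Ls : set (Rn R dL).
Hypothesis mkappa : measurable_fun [set: Rn R dL] kappa.
Hypothesis mp : measurable_fun [set: Rn R dZ * Rn R dL] p.
Hypothesis Zs_kappa : forall l, Ls l ->
  {ae (kappa l : probability _ R), forall az, Zs az.2}.
Hypothesis p_kappa : forall l, Ls l ->
  regular_cond_law (kappa l) fst snd (fun z => p (z, l)).

Implicit Types (a : 'I_M.+1) (l : Rn R dL) (f g : Rn R dZ * Rn R dL -> R).

Local Notation treated a := (fun az : 'I_M.+1 * Rn R dZ => (az.1 == a)%:R : R).
Local Notation slice f l := (fun az : 'I_M.+1 * Rn R dZ => f (az.2, l)).

Lemma cond_prob_ge0 a zl : 0 <= cond_prob p a zl.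
Proof. by rewrite fine_ge0. Qed.

Lemma cond_prob_le1 a zl : cond_prob p a zl <= 1.
Proof.
by rewrite -lee_fin fineK ?fin_num_measure// probability_le1.
Qed.

Lemma norm_cond_prob_le1 a zl : `|cond_prob p a zl| <= 1.
Proof. by rewrite ger0_norm ?cond_prob_ge0 ?cond_prob_le1. Qed.

Lemma measurable_cond_prob a :
  measurable_fun [set: Rn R dZ * Rn R dL] (cond_prob p a).
Proof.
apply: (measurableT_comp (fine_measurable _)) => //.
exact: (measurable_kernel (kprobability mp) [set a] _).
Qed.

Lemma treatedE a : treated a = \1_(fst @^-1` [set a]).
Proof.
apply/funext => az; rewrite indicE; congr (_%:R); congr nat_of_bool.
by apply/eqP/idP => [<-|/set_mem//]; apply/mem_set.
Qed.

Lemma measurable_treated a :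
  measurable_fun [set: 'I_M.+1 * Rn R dZ] (treated a).
Proof.
rewrite treatedE; apply: measurable_indic; rewrite -[X in measurable X]setTI.
exact: measurable_fst.
Qed.

Lemma norm_treated_le1 a az : `|treated a az| <= 1.
Proof. by rewrite normr_nat lern1 leq_b1. Qed.

Lemma treated_Lfun2 a l : treated a \in Lfun (kappa l : probability _ R) 2%:E.
Proof.
exact: (bounded_Lfun2 _ (measurable_treated a) (norm_treated_le1 a)).
Qed.

Lemma measurable_slice f l : measurable_fun [set: Rn R dZ * Rn R dL] f ->
  measurable_fun [set: 'I_M.+1 * Rn R dZ] (slice f l).
Proof.
move=> mf; apply: (measurableT_comp mf).
by apply: measurable_fun_pair => //; exact: measurable_cst.
Qed.

Lemma slice_Lfun2 f l C :
  measurable_fun [set: Rn R dZ * Rn R dL] f -> (forall zl, `|f zl| <= C) ->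
  slice f l \in Lfun (kappa l : probability _ R) 2%:E.
Proof.
move=> mf fC; apply: (bounded_Lfun2 _ (measurable_slice l mf)) => az.
exact: fC.
Qed.

Lemma cond_prob_Lfun2 a l :
  slice (cond_prob p a) l \in Lfun (kappa l : probability _ R) 2%:E.
Proof. exact: slice_Lfun2 (measurable_cond_prob a) (norm_cond_prob_le1 a). Qed.

(** The defining property of the conditional law [p (z, l)] under [kappa l], used for the singleton
    of [a], says that the indicator and the conditional probability have equal integrals over every
    event Z in B. [ge0_integral_factor] extends this to weights [g]. *)
Lemma ge0_expectation_treated a l (g : Rn R dZ -> R) : Ls l ->
  measurable_fun [set: Rn R dZ] g -> (forall z, 0 <= g z) ->
  ('E_(kappa l)[(fun az => g az.2 * treated a az)%R] =
   'E_(kappa l)[(fun az => g az.2 * cond_prob p a (az.2, l))%R])%E.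
Proof.
move=> Lsl mg g0; rewrite expectation.unlock.
apply: (@ge0_integral_factor _ _ _ _ _ _ _ _ snd g) => //.
- exact: measurable_treated.
- apply: measurable_slice; exact: measurable_cond_prob.
- by move=> az; exact: cond_prob_ge0.
move=> B mB.
have mBY : measurable (snd @^-1` B : set ('I_M.+1 * Rn R dZ)).
  by rewrite -[X in measurable X]setTI; exact: measurable_snd.
have [_ /(_ [set a] B Logic.I mB) kE] := p_kappa Lsl.
transitivity (\int[kappa l]_(az in snd @^-1` B) p (az.2, l) [set a])%E;
    last first.
  by apply: eq_integral => az _; rewrite fineK ?fin_num_measure.
rewrite -kE.
under eq_integral => az _ do rewrite -[_%:R]/(treated a az) treatedE.
rewrite integral_indic// -[X in measurable X]setTI.
exact: measurable_fst.
Qed.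

(** A bounded signed weight is the difference of the nonnegative weights [f + C] and [C], to each of
    which the nonnegative case applies. *)
Lemma expectation_treated a l f C : Ls l ->
  measurable_fun [set: Rn R dZ * Rn R dL] f -> (forall zl, `|f zl| <= C) ->
  ('E_(kappa l)[(treated a \* slice f l)%R] =
   'E_(kappa l)[(slice (cond_prob p a) l \* slice f l)%R])%E.
Proof.
move=> Lsl mf fC.
have C0 : 0 <= C by rewrite (le_trans _ (fC point)).
(* Stated for a general [X] because both the indicator and the conditional probability are
   substituted for it. *)
have split_nonneg (X : 'I_M.+1 * Rn R dZ -> R) :
    measurable_fun [set: 'I_M.+1 * Rn R dZ] X -> (forall az, `|X az| <= 1) ->
  ('E_(kappa l)[(X \* slice f l)%R] =
     'E_(kappa l)[(fun az => (f (az.2, l) + C) * X az)%R] -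
     'E_(kappa l)[(fun az => C * X az)%R])%E.
  move=> mX X1.
  have X2 : X \in Lfun (kappa l : probability _ R) 2%:E.
    exact: (bounded_Lfun2 _ mX X1).
  have f2 := slice_Lfun2 l mf fC.
  have c2 : cst C \in Lfun (kappa l : probability _ R) 2%:E by exact: Lfun_cst.
  have fc2 : slice f l \+ cst C \in Lfun (kappa l : probability _ R) 2%:E.
    by rewrite rpredD ?lee1n.
  rewrite -expectationB.
  - by congr expectation; apply/funext => az /=; ring.
  - exact: (Lfun2_mul_Lfun1 fc2 X2).
  - exact: (Lfun2_mul_Lfun1 c2 X2).
rewrite !split_nonneg; first congr (_ - _)%E.
- apply: (@ge0_expectation_treated a l (fun z => f (z, l) + C)) => //.
  + apply: measurable_funD => //; apply: (measurableT_comp mf).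
    by apply: measurable_fun_pair => //; exact: measurable_cst.
  + move=> z; rewrite -lerBlDr sub0r.
    by have := fC (z, l); rewrite ler_norml => /andP[].
- exact: (@ge0_expectation_treated a l (cst C)).
- apply: measurable_slice; exact: measurable_cond_prob.
- by move=> az; exact: norm_cond_prob_le1.
- exact: measurable_treated.
- exact: norm_treated_le1.
Qed.

Lemma cond_cov_treatmentE a f l C : Ls l ->
  measurable_fun [set: Rn R dZ * Rn R dL] f -> (forall zl, `|f zl| <= C) ->
  cond_cov_treatment kappa a f l =
  covariance (kappa l) (slice (cond_prob p a) l) (slice f l).
Proof.
move=> Lsl mf fC; rewrite /cond_cov_treatment.
have P1 := fin_num_measure (kappa l : probability _ R) _ measurableT.
have X2 := treated_Lfun2 a l.
have h2 := cond_prob_Lfun2 a l.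
have f2 := slice_Lfun2 l mf fC.
rewrite !covarianceE ?Lfun2_mul_Lfun1 ?(Lfun_subset12 P1)//.
rewrite (expectation_treated a Lsl mf fC); congr (_ - _ * _)%E.
have c1 : forall zl : Rn R dZ * Rn R dL, `|cst 1 zl : R| <= 1.
  by move=> zl; rewrite /= normr1.
(* The constant weight 1 shows that the indicator and the conditional probability have the same
   mean. *)
have := expectation_treated a Lsl (measurable_cst (1 : R)) c1.
have mul1 (X : 'I_M.+1 * Rn R dZ -> R) : X \* (fun=> 1%R) = X.
  by apply/funext => az /=; rewrite mulr1.
by rewrite !mul1.
Qed.

Lemma cond_cov_treatment_cond_prob a l : Ls l ->
  cond_cov_treatment kappa a (cond_prob p a) l =
  cond_var kappa (cond_prob p a) l.
Proof.
move=> Lsl.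
apply: (cond_cov_treatmentE a Lsl (measurable_cond_prob a)).
exact: norm_cond_prob_le1.
Qed.

(** * Regular weighting functions for a single treatment level *)

Lemma fin_num_cond_cov a f l C : Ls l ->
  measurable_fun [set: Rn R dZ * Rn R dL] f -> (forall zl, `|f zl| <= C) ->
  cond_cov_treatment kappa a f l \is a fin_num.
Proof.
move=> Lsl mf fC; rewrite (cond_cov_treatmentE a Lsl mf fC).
have P1 := fin_num_measure (kappa l : probability _ R) _ measurableT.
have f2 := slice_Lfun2 l mf fC; have h2 := cond_prob_Lfun2 a l.
by rewrite covariance_fin_num ?Lfun2_mul_Lfun1 ?(Lfun_subset12 P1).
Qed.

Lemma sqr_cond_cov_le a f l C : Ls l ->
  measurable_fun [set: Rn R dZ * Rn R dL] f -> (forall zl, `|f zl| <= C) ->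
  fine (cond_cov_treatment kappa a f l) ^+ 2 <=
  fine (cond_var kappa (cond_prob p a) l) * C ^+ 2.
Proof.
move=> Lsl mf fC; rewrite (cond_cov_treatmentE a Lsl mf fC).
have f2 := slice_Lfun2 l mf fC.
apply: le_trans (sqr_covariance_le (cond_prob_Lfun2 a l) f2) _.
rewrite ler_wpM2l ?fine_ge0 ?variance_ge0//.
by apply: variance_bound; [exact: measurable_slice|move=> az; exact: fC].
Qed.

(** A weighting function is bounded only on [Zs] x [Ls], while the covariance estimates ask for a
    global bound. Truncation supplies one without changing the covariance at [l] in [Ls], because
    [Zs] has full measure under [kappa l]. *)
Lemma RWF_at_cond_var a : (exists f, RWF_at kappa Zs Ls a f) ->
  exists2 e : R, 0 < e &
    forall l, Ls l -> (e%:E <= cond_var kappa (cond_prob p a) l)%E.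
Proof.
move=> [f [mf [C0 fC0] [e e0 ef]]].
(* The maximum with 1 makes the bound positive, so that its square can be a denominator. *)
pose C := Num.max C0 1.
have C_gt0 : 0 < C by rewrite lt_max ltr01 orbT.
have fC z l : Zs z -> Ls l -> `|f (z, l)| <= C.
  by move=> Zz Ll; rewrite le_max fC0.
pose g zl := Num.max (- C) (Num.min C (f zl)).
have mg : measurable_fun [set: Rn R dZ * Rn R dL] g.
  by apply: measurable_maxr => //; exact: measurable_minr.
have gC zl : `|g zl| <= C.
  rewrite ler_norml le_max lexx/= ge_max ge_min lexx andbT.
    by rewrite ge0_cp// ltW.
have fg z l : Zs z -> Ls l -> f (z, l) = g (z, l).
  move=> Zz Ll; have := fC z l Zz Ll; rewrite ler_norml => /andP[? ?].
  by rewrite /g min_r// max_r.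
(* The constant comes from e^2 <= Cov^2 <= Var * C^2. *)
exists (e ^+ 2 / C ^+ 2) => [|l Ll]; first by rewrite divr_gt0 ?exprn_gt0.
have covE : cond_cov_treatment kappa a f l = cond_cov_treatment kappa a g l.
  apply: covariance_ae_eqr.
  1: exact: measurable_treated.
  1,2: exact: measurable_slice.
  by apply: filterS (Zs_kappa Ll) => az Zz; exact: fg.
have := ef l Ll.
rewrite covE -(fineK (fin_num_cond_cov a Ll mg gC)) lee_fin => ec.
rewrite -[leRHS]fineK ?variance_fin_num ?cond_prob_Lfun2// lee_fin.
rewrite ler_pdivrMr ?exprn_gt0// (le_trans _ (sqr_cond_cov_le a Ll mg gC))//.
by rewrite -[leRHS]real_normK ?num_real// lerXn2r ?nnegrE// ltW.
Qed.

Lemma RWF_at_cond_prob a (e : R) : 0 < e ->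
  (forall l, Ls l -> (e%:E <= cond_var kappa (cond_prob p a) l)%E) ->
  RWF_at kappa Zs Ls a (cond_prob p a).
Proof.
move=> e0 ev; split; first exact: measurable_cond_prob.
- by exists 1 => z l _ _; exact: norm_cond_prob_le1.
- exists e => // l Ll; rewrite cond_cov_treatment_cond_prob//.
  by rewrite gee0_abs ?variance_ge0// ev.
Qed.

(** * One weighting function for all treatment levels *)

Lemma measurable_cond_cov a f C :
  measurable_fun [set: Rn R dZ * Rn R dL] f -> (forall zl, `|f zl| <= C) ->
  measurable_fun [set: Rn R dL]
    (fun l => fine (cond_cov_treatment kappa a f l)).
Proof.
move=> mf fC; apply: (measurableT_comp (fine_measurable _)) => //.
have mT : measurable_fun [set: Rn R dL * ('I_M.+1 * Rn R dZ)]
    (fun laz => treated a laz.2).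
  exact: (measurableT_comp (measurable_treated a)).
have mF : measurable_fun [set: Rn R dL * ('I_M.+1 * Rn R dZ)]
    (fun laz => f (laz.2.2, laz.1)).
  apply: (measurableT_comp mf); apply: measurable_fun_pair => //.
  exact: measurableT_comp.
(* With Cov(X, Y) = E[XY] - E[X] E[Y], each term is an expectation under the kernel [kappa]. *)
apply: (eq_measurable_fun (fun l => 'E_(kappa l)[(treated a \* slice f l)%R] -
              'E_(kappa l)[treated a] * 'E_(kappa l)[slice f l])%E) => [l _|].
  rewrite /cond_cov_treatment.
  have P1 := fin_num_measure (kappa l : probability _ R) _ measurableT.
  have f2 := slice_Lfun2 l mf fC.
  have X2 := treated_Lfun2 a l.
  by rewrite covarianceE ?Lfun2_mul_Lfun1 ?(Lfun_subset12 P1).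
apply: emeasurable_funB; last apply: emeasurable_funM.
- apply: (@measurable_expectation_kernel _ _ _ _ _ kappa
    (fun laz => treated a laz.2 * f (laz.2.2, laz.1))) => //.
  exact: measurable_funM.
- exact: (@measurable_expectation_kernel _ _ _ _ _ kappa
    (fun laz => treated a laz.2)).
- exact: (@measurable_expectation_kernel _ _ _ _ _ kappa
    (fun laz => f (laz.2.2, laz.1))).
Qed.

(** With [l] fixed, the coefficient [r] may vary with [l]; it is later d/2 times an indicator
    evaluated at [l]. *)
Lemma cond_covD a f g l (r : R) C C' :
  measurable_fun [set: Rn R dZ * Rn R dL] f -> (forall zl, `|f zl| <= C) ->
  measurable_fun [set: Rn R dZ * Rn R dL] g -> (forall zl, `|g zl| <= C') ->
  covariance (kappa l) (treated a) (fun az => f (az.2, l) + r * g (az.2, l)) =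
  (cond_cov_treatment kappa a f l + r%:E * cond_cov_treatment kappa a g l)%E.
Proof.
move=> mf fC mg gC'.
have P1 := fin_num_measure (kappa l : probability _ R) _ measurableT.
have f2 := slice_Lfun2 l mf fC; have g2 := slice_Lfun2 l mg gC'.
have X2 := treated_Lfun2 a l.
have rg2 : r \o* slice g l \in Lfun (kappa l : probability _ R) 2%:E.
  by apply: Lfun_scale => //; rewrite ler1n.
have -> : (fun az : 'I_M.+1 * Rn R dZ => f (az.2, l) + r * g (az.2, l)) =
    (slice f l \+ r \o* slice g l).
  by apply/funext => az /=; rewrite [r * _]mulrC.
by rewrite covarianceDr// covarianceZr ?Lfun2_mul_Lfun1 ?(Lfun_subset12 P1).
Qed.

(** When |x| is below the threshold, x > - d e / 4, and the correction adds at least d e / 2.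
    Otherwise |x| is already large enough. *)
Lemma perturbation_lower_bound (x y d e : R) : 0 < d -> 0 < e -> e <= y ->
  let x' := if `|x| < d * e / 4 then x + d / 2 * y else x in
  d * e / 4 <= `|x'|.
Proof.
move=> d0 e0 ey; case: ltP => //= xs.
have : d / 2 * e <= d / 2 * y by rewrite ler_wpM2l// divr_ge0// ltW.
move: xs; rewrite ltr_norml => /andP[? ?] ?.
by rewrite ler_normr; apply/orP; left; lra.
Qed.

Lemma strong_IV_RWF : strong_IV_relevance kappa p Ls ->
  exists f, RWF kappa Zs Ls f.
Proof.
move=> [e e0 ev].
have vE b l : Ls l -> e <= fine (cond_cov_treatment kappa b (cond_prob p b) l).
  move=> Ll; rewrite cond_cov_treatment_cond_prob// -lee_fin fineK ?ev//.
  by rewrite variance_fin_num ?cond_prob_Lfun2.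
(* Cauchy-Schwarz, with both variances at most 1. *)
have cov1 b k l : Ls l ->
    `|fine (cond_cov_treatment kappa b (cond_prob p k) l)| <= 1.
  move=> Ll.
  rewrite -(@ler_pXn2r _ 2) ?nnegrE// real_normK ?num_real// expr1n.
  have mk := measurable_cond_prob k.
  apply: le_trans (sqr_cond_cov_le b Ll mk (norm_cond_prob_le1 k)) _.
  rewrite expr1n mulr1 -(expr1n R 2).
  apply: variance_bound; last by move=> az; exact: norm_cond_prob_le1.
  apply: measurable_slice; exact: measurable_cond_prob.
(* Induction on the number [k] of levels already handled, carrying a global bound [C] and a
   covariance bound [d] uniform in [l]. *)
suff H k : (k <= M.+1)%N -> exists f C (d : R),
    [/\ measurable_fun [set: Rn R dZ * Rn R dL] f,
        forall zl, `|f zl| <= C, 0 < d &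
        forall (b : 'I_M.+1) l, (b < k)%N -> Ls l ->
          d <= `|fine (cond_cov_treatment kappa b f l)|].
  have [f [C [d [mf fC d0 fd]]]] := H M.+1 (leqnn _).
  exists f => a; split => //; first by exists C => *; exact: fC.
  exists d => // l Ll; rewrite -(fineK (fin_num_cond_cov a Ll mf fC)) lee_fin.
  by rewrite fd.
elim: k => [_|k IH kM].
  by exists (cst 0), 0, 1; split => // zl; rewrite normr0.
have [f [C [d [mf fC d0 fd]]]] := IH (ltnW kM).
pose a : 'I_M.+1 := Ordinal kM.
pose S := [set l | `|fine (cond_cov_treatment kappa a f l)| < d * e / 4].
(* The indicator confines the correction to those [l] where [f] fails at the new level. *)
pose g zl := f zl + d / 2 * \1_S zl.2 * cond_prob p a zl.
(* [S] is a sublevel set of a measurable function of [l]; this keeps [g] measurable. *)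
have mS : measurable S.
  have mc : measurable_fun [set: Rn R dL]
      (fun l => `|fine (cond_cov_treatment kappa a f l)|).
    exact: (measurableT_comp _ (measurable_cond_cov a mf fC)).
  have := measurable_fun_ltr mc (measurable_cst (d * e / 4)).
  move=> /(_ measurableT [set true] Logic.I); rewrite setTI.
  by rewrite -[X in measurable X -> _]/S.
have mg : measurable_fun [set: Rn R dZ * Rn R dL] g.
  apply: measurable_funD => //.
  apply: measurable_funM; last exact: measurable_cond_prob.
  apply: measurable_funM => //; apply: (measurableT_comp (measurable_indic mS)).
  exact: measurable_snd.
have step_le l : `|d / 2 * \1_S l| <= d / 2.
  rewrite normrM -[leRHS]mulr1 ler_pM//.
    by rewrite ger0_norm// divr_ge0// ltW.
  by rewrite indicE normr_nat lern1 leq_b1.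
have gC zl : `|g zl| <= C + d / 2.
  apply: le_trans (ler_normD _ _) _; rewrite lerD// normrM -[leRHS]mulr1.
  by rewrite ler_pM// norm_cond_prob_le1.
have covg b l : Ls l -> fine (cond_cov_treatment kappa b g l) =
    fine (cond_cov_treatment kappa b f l) +
    d / 2 * \1_S l * fine (cond_cov_treatment kappa b (cond_prob p a) l).
  move=> Ll; have ma := measurable_cond_prob a; have a1 := norm_cond_prob_le1 a.
  have -> : cond_cov_treatment kappa b g l = (cond_cov_treatment kappa b f l +
      (d / 2 * \1_S l)%:E * cond_cov_treatment kappa b (cond_prob p a) l)%E.
    exact: (cond_covD b l (d / 2 * \1_S l) mf fC ma a1).
  have fa := fin_num_cond_cov b Ll ma a1.
  by rewrite fineD ?fineM ?fin_numM// (fin_num_cond_cov b Ll mf fC).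
(* The first entry of the minimum serves the levels below [k], the second the level [k] itself. *)
exists g, (C + d / 2), (Num.min (d / 2) (d * e / 4)); split => //.
  by rewrite lt_min !divr_gt0 ?mulr_gt0.
move=> b l bk Ll; rewrite covg// ge_min.
have [bk'|kb] := ltnP b k.
  apply/orP; left.
  have := fd b l bk' Ll; have := cov1 b a l Ll.
  set x := fine (cond_cov_treatment kappa b f l).
  set y := fine (cond_cov_treatment kappa b _ l) => y1 dx.
  (* The correction moves an old covariance, at least [d] in absolute value, by at most d / 2. *)
  have : `|d / 2 * \1_S l * y| <= d / 2.
    by rewrite normrM -[leRHS]mulr1 ler_pM.
  set z := d / 2 * _ * _ => zd.
  have : `|x| <= `|x + z| + `|z|.
    by rewrite -[in leLHS](addrK z x) (le_trans (ler_normD _ _))// normrN.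
  by move=> ?; lra.
(* From k <= b < k + 1 the level is the new one. *)
have -> : b = a by apply/val_inj/eqP; rewrite eqn_leq kb -ltnS bk.
apply/orP; right.
have := perturbation_lower_bound (fine (cond_cov_treatment kappa a f l))
  d0 e0 (vE a l Ll).
rewrite /= indicE; case: ifPn => lS.
  by rewrite mem_set// mulr1.
by rewrite memNset ?mulr0 ?mul0r ?addr0//; apply/negP.
Qed.

End weighting_functions.

(** * The equivalence with strong IV relevance and the canonical weighting function *)

Unset Implicit Arguments.

Theorem proposition2p1 (R : realType) (d : measure_display)
    (Omega : measurableType d) (P : probability Omega R) (M dZ dL : nat)
    (Zs : set (Rn R dZ)) (Ls : set (Rn R dL))
    (A : Omega -> 'I_M.+1) (Z : Omega -> Rn R dZ) (L : Omega -> Rn R dL)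
    (mA : measurable_fun [set: Omega] A)
    (mZ : measurable_fun [set: Omega] Z)
    (mL : measurable_fun [set: Omega] L)
    (ZsP : {ae P, forall w, Zs (Z w)})
    (LsP : {ae P, forall w, Ls (L w)})
    (kappa : Rn R dL -> pprobability ('I_M.+1 * Rn R dZ)%type R)
    (p : Rn R dZ * Rn R dL -> pprobability 'I_M.+1 R)
    (kappaP : regular_cond_law P (fun w => (A w, Z w)) L kappa)
    (pP : regular_cond_law P A (fun w => (Z w, L w)) p)
    (Zs_kappa : forall l, Ls l ->
       {ae (kappa l : probability _ R), forall az, Zs az.2})
    (p_kappa : forall l, Ls l ->
       regular_cond_law (kappa l) fst snd (fun z => p (z, l))) :
  ((exists pi, RWF kappa Zs Ls pi) <-> strong_IV_relevance kappa p Ls) /\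
  (forall a : 'I_M.+1, (exists pi, RWF_at kappa Zs Ls a pi) ->
     RWF_at kappa Zs Ls a (cond_prob p a)).
Proof.
have [mkappa _] := kappaP; have [mp _] := pP.
split; [split|].
- move=> [pi RWFpi].
  have /choice[e eP] : forall a : 'I_M.+1, exists e : R, 0 < e /\
      forall l, Ls l -> (e%:E <= cond_var kappa (cond_prob p a) l)%E.
    move=> a; have [|e e0 ev] := RWF_at_cond_var mp Zs_kappa p_kappa (a := a).
      by exists pi.
    by exists e.
  (* Each level has its own constant; as there are finitely many levels, their minimum, capped by
     the default value 1, is still positive. *)
  exists (\big[Num.min/1]_a e a) => [|l a Ll].
    by apply: lt_bigmin => // a _; have [] := eP a.
  by apply: le_trans (proj2 (eP a) l Ll); rewrite lee_fin; exact: bigmin_le.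
- exact: strong_IV_RWF.
- move=> a /(RWF_at_cond_var mp Zs_kappa p_kappa)[e e0 ev].
  exact: RWF_at_cond_prob ev.
Qed.
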